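(* Let $n\ge 1$, let $\alpha_1,\alpha_2,\alpha_3\in\mathbb{R}$ be parameters, and for $0\le r\le n-1$ let $$I_r=\alpha_1\left(\frac{f_2f_4\cdots f_{2n}}{f_1f_3\cdots f_{2n-1}}\,\Theta^{1,2n}_{2r,1}+\frac{f_1f_3\cdots f_{2n-1}}{f_2f_4\cdots f_{2n}}\,\Theta^{1,2n}_{2r,0}\right)+\alpha_2\,\Theta^{1,2n}_{2r+1,1}+\alpha_3\,\Theta^{1,2n}_{2r+1,0},$$ a function of the nonzero real variables $f_1,\dots,f_{2n}$. Then for all $0\le r,s\le n-1$, $$\{I_r,I_s\}_f=0.$$
   Context: For integers $a\le b$, $r\ge 0$, and $\epsilon$ an integer (only its residue mod 2 matters), the multi-sum with argument $f_i$ is $$\Theta^{a,b}_{r,\epsilon}=\sum_{a\le i_1<i_2<\cdots<i_r\le b}\ \prod_{j=1}^r (f_{i_j})^{(-1)^{j+\epsilon}},$$ with $\Theta^{a,b}_{0,\epsilon}=1$ (and $\Theta^{a,b}_{r,\epsilon}=0$ for $r>b-a+1$). The Poisson bracket of differentiable functions $g,h$ of $f_1,\dots,f_{2n}$ is $$\{g,h\}_f=\sum_{1\le i<j\le 2n} f_if_j\left(\frac{\partial g}{\partial f_i}\frac{\partial h}{\partial f_j}-\frac{\partial g}{\partial f_j}\frac{\partial h}{\partial f_i}\right),$$ i.e. $\{f_i,f_j\}_f=f_if_j$ for $i<j$. *)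

(* Defs.v *)
From HB Require Import structures.
From mathcomp Require Import all_boot all_order all_algebra.
From mathcomp Require Import all_classical all_reals all_analysis.
Import Order.TTheory GRing.Theory Num.Theory.
Import numFieldNormedType.Exports.

Set Implicit Arguments.
Unset Strict Implicit.
Unset Printing Implicit Defensive.

Local Open Scope ring_scope.

(* A point (f_1, ..., f_m) is a row vector f; ordinals start at 0, so f_k is
   the entry f 0 i with i.+1 = k.  The sum is over strictly increasing
   i : {ffun 'I_r -> 'I_m}, standing for the selection
   a <= (i 0).+1 < ... < (i (r - 1)).+1 <= b; the factor numbered j >= 1 in the
   product is that of the ordinal j - 1, hence the j.+1 in the exponent.  Both
   powers are integer powers: the exponent of f is the integer 1 or -1. *)
Definition Theta (R : realType) (m a b r : nat) (eps : int)
    (f : 'rV[R]_m) : R :=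
  \sum_(i : {ffun 'I_r -> 'I_m} |
          [forall j : 'I_r, (a <= (i j).+1 <= b)%N] &&
          [forall j : 'I_r, forall k : 'I_r, (j < k)%N ==> (i j < i k)%N])
    \prod_(j < r) f 0 (i j) ^ ((-1 : int) ^ (j.+1%:Z + eps)).

Definition partial (R : realType) (m : nat) (i : 'I_m)
    (g : 'rV[R]_m -> R) (f : 'rV[R]_m) : R :=
  'D_(delta_mx 0 i) g f.

Definition poisson (R : realType) (m : nat) (g h : 'rV[R]_m -> R)
    (f : 'rV[R]_m) : R :=
  \sum_(i < m) \sum_(j < m | (i < j)%N)
    f 0 i * f 0 j *
    (partial i g f * partial j h f - partial j g f * partial i h f).

(* f_k with k even is the entry at an odd ordinal, and conversely. *)
Definition prod_even (R : realType) (m : nat) (f : 'rV[R]_m) : R :=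
  \prod_(i < m | odd i) f 0 i.

Definition prod_odd (R : realType) (m : nat) (f : 'rV[R]_m) : R :=
  \prod_(i < m | ~~ odd i) f 0 i.

Definition integral_I (R : realType) (n : nat) (alpha1 alpha2 alpha3 : R)
    (r : nat) (f : 'rV[R]_(2 * n)) : R :=
  alpha1 * (prod_even f / prod_odd f * Theta 1 (2 * n) (2 * r) 1 f +
            prod_odd f / prod_even f * Theta 1 (2 * n) (2 * r) 0 f) +
  alpha2 * Theta 1 (2 * n) (2 * r + 1) 1 f +
  alpha3 * Theta 1 (2 * n) (2 * r + 1) 0 f.

(* Main.v *)
Require Import Defs.
From HB Require Import structures.
From mathcomp Require Import all_boot all_order all_algebra.
From mathcomp Require Import all_classical all_reals all_analysis.
From mathcomp Require Import ring zify.
Import Order.TTheory GRing.Theory Num.Theory.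
Import numFieldNormedType.Exports.
Local Open Scope ring_scope.

Set Implicit Arguments.
Unset Strict Implicit.
Unset Printing Implicit Defensive.

(* With L_k(l) = [[1, l / f_k], [l * f_k, 1]], the entries of the monodromy
   matrix M(l) = L_1(l) ... L_2n(l) are the generating functions in l of the
   multi-sums Theta of even (diagonal) and odd (off-diagonal) length.  The
   brackets of entries of M(l) and M(m) close quadratically,
     {M(l) (x) M(m)} = 1/4 [M(l) (x) M(m), r] + boundary terms,
   with a trigonometric r-matrix r(l, m), which is proved by adjoining one site
   at a time.  The ratio p = f_2 f_4 ... / (f_1 f_3 ...) satisfies
   {f_k, p} = f_k p for every k, so its brackets with the entries of M(l) are
   those of the Euler operator.  These relations give {H(l), H(m)} = 0 for
     H(l) = sum_r l^(2r) I_r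
          = alpha1 (p M_22 + M_11 / p) + (alpha2 M_21 + alpha3 M_12) / l
   whenever l^2 <> m^2, and the coefficients can then be separated. *)

(** * The bracket as a bilinear form *)

Definition sgn_mx (R : numFieldType) (m : nat) : 'M[R]_m :=
  \matrix_(i, j) ((i < j)%N%:R - (j < i)%N%:R).

(* The Poisson bracket in the coordinates log f_k, as a form on gradients. *)
Definition log_bracket (R : numFieldType) (m : nat) (u v : 'rV[R]_m) : R :=
  (u *m sgn_mx R m *m v^T) 0 0.

Section LogBracket.
Variables (R : numFieldType) (m : nat).
Implicit Types u v : 'rV[R]_m.

Lemma log_bracketDl u u' v :
  log_bracket (u + u') v = log_bracket u v + log_bracket u' v.
Proof. by rewrite /log_bracket !mulmxDl mxE. Qed.

Lemma log_bracketZl c u v : log_bracket (c *: u) v = c * log_bracket u v.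
Proof. by rewrite /log_bracket -!scalemxAl mxE. Qed.

Lemma log_bracketC u v : log_bracket u v = - log_bracket v u.
Proof.
rewrite /log_bracket; transitivity ((u *m sgn_mx R m *m v^T)^T 0 0).
  by rewrite [RHS]mxE.
rewrite !trmx_mul trmxK mulmxA.
have -> : (sgn_mx R m)^T = - sgn_mx R m.
  by apply/matrixP => i j; rewrite !mxE opprB.
by rewrite mulmxN mulNmx mxE.
Qed.

Lemma log_bracketDr u v v' :
  log_bracket u (v + v') = log_bracket u v + log_bracket u v'.
Proof. by rewrite /log_bracket linearD /= mulmxDr mxE. Qed.

Lemma log_bracketZr c u v : log_bracket u (c *: v) = c * log_bracket u v.
Proof. by rewrite /log_bracket linearZ /= -scalemxAr mxE. Qed.

Lemma log_bracketE u v :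
  log_bracket u v =
  \sum_(i < m) \sum_(j < m | (i < j)%N) (u 0 i * v 0 j - u 0 j * v 0 i).
Proof.
under [RHS]eq_bigr do rewrite sumrB.
rewrite sumrB [X in _ - X](exchange_big_dep xpredT) //= -sumrB /log_bracket mxE.
under eq_bigr do rewrite !mxE mulr_suml.
rewrite exchange_big /=; apply: eq_bigr => i _.
rewrite [X in X - _]big_mkcond [X in _ - X]big_mkcond /= -sumrB.
apply: eq_bigr => j _; rewrite !mxE.
by case: ltngtP => _; 
  rewrite ?(subr0, sub0r, mulr1, mulr0, mul0r, mulrN, mulNr).
Qed.

Lemma log_bracket0r u : log_bracket u 0 = 0.
Proof. by rewrite -(scale0r 0) log_bracketZr mul0r. Qed.

Lemma log_bracket_sumr n u (b : 'I_n -> R) (v : 'I_n -> 'rV[R]_m) :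
  log_bracket u (\sum_h b h *: v h) = \sum_h b h * log_bracket u (v h).
Proof.
rewrite (big_morph (log_bracket u) (log_bracketDr u) (log_bracket0r u)).
by apply: eq_bigr => h _; rewrite log_bracketZr.
Qed.

(** The nested form on the right lets the coefficients in one parameter be separated before those in
    the other. *)
Lemma log_bracket_sum n p (a : 'I_n -> R) (b : 'I_p -> R)
    (u : 'I_n -> 'rV[R]_m) (v : 'I_p -> 'rV[R]_m) :
  log_bracket (\sum_k a k *: u k) (\sum_h b h *: v h) =
  \sum_h b h * (\sum_k a k * log_bracket (u k) (v h)).
Proof.
rewrite log_bracket_sumr; apply: eq_bigr => h _; congr (_ * _).
rewrite log_bracketC log_bracket_sumr -sumrN.
by apply: eq_bigr => k _; rewrite -mulrN -log_bracketC.
Qed.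

Lemma log_bracketvv u : log_bracket u u = 0.
Proof. by rewrite log_bracketE; do 2 apply: big1 => ? _; ring. Qed.

(** All signs against [k] are +1 on the support of [u], so the bracket with the logarithm of a
    variable that comes after all those in use is the Euler operator. *)
Lemma log_bracket_delta u (k : 'I_m) :
  (forall i : 'I_m, (k <= i)%N -> u 0 i = 0) ->
  log_bracket u (delta_mx 0 k) = \sum_i u 0 i.
Proof.
move=> Hu; rewrite /log_bracket trmx_delta -colE !mxE; apply: eq_bigr => i _.
rewrite !mxE; case: (ltnP i k) => ik; last by rewrite Hu ?mul0r.
by rewrite ltnNge (ltnW ik) subr0 mulr1.
Qed.

End LogBracket.

(** * Quadratic brackets when one site is adjoined *)

Definition bsgn (R : pzRingType) (b : bool) : R := if b then -1 else 1.
Arguments bsgn R b /.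

(* The right-hand side of the bracket relation between the entries M i j at l
   and N k h at m.  Indices false and true stand for 1 and 2. *)
Definition quad_bracket (R : fieldType) (l m : R) (M N : bool -> bool -> R)
    (i j k h : bool) : R :=
  let s := bsgn R in
  (((l ^+ 2 + m ^+ 2) * (s j * s h - s i * s k) +
    (m ^+ 2 - l ^+ 2) * (s j * s k - s i * s h)) * M i j * N k h +
   4 * l * m * ((j != h)%:R * M i h * N k j - (i != k)%:R * M k j * N i h)) /
  (4 * (m ^+ 2 - l ^+ 2)).

(* The entry of L_k(1) in column b off the diagonal, for x = f_k. *)
Definition site (R : unitRingType) (x : R) (b : bool) := if b then x^-1 else x.

(** [G] and [H] stand for the logarithmic gradients of the entries [M] and [N], and [x] for the new
    variable. Old-old brackets are quadratic by assumption, old-new ones are Euler operators, and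
    the new-new one vanishes; what remains is a rational identity for each of the 16 index
    choices. *)
Lemma log_bracket_step (R : numFieldType) (d : nat) (k0 : 'I_d) (x l m : R)
  (M N : bool -> bool -> R) (G H : bool -> bool -> 'rV[R]_d) :
  x != 0 -> m ^+ 2 - l ^+ 2 != 0 ->
  (forall i j k h, log_bracket (G i j) (H k h) = quad_bracket l m M N i j k h) ->
  (forall i j, log_bracket (G i j) (delta_mx 0 k0) =
     (bsgn R j - bsgn R i) / 2 * M i j) ->
  (forall i j, log_bracket (H i j) (delta_mx 0 k0) =
     (bsgn R j - bsgn R i) / 2 * N i j) ->
  forall i j k h,
  log_bracket
    (G i j + ((l * site x j) *: G i (~~ j) +
              (l * site x j * bsgn R j * M i (~~ j)) *: delta_mx 0 k0))
    (H k h + ((m * site x h) *: H k (~~ h) +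
              (m * site x h * bsgn R h * N k (~~ h)) *: delta_mx 0 k0)) =
  quad_bracket l m (fun i j => M i j + l * site x j * M i (~~ j))
          (fun i j => N i j + m * site x j * N i (~~ j)) i j k h.
Proof.
move=> x0 D0 GH Ge He i j k h.
rewrite !(log_bracketDl, log_bracketDr, log_bracketZl, log_bracketZr).
rewrite log_bracketvv !(log_bracketC (delta_mx _ _)) !GH !Ge !He /quad_bracket.
by case: i; case: j; case: k; case: h => /=; field; rewrite ?x0 ?D0.
Qed.

(** * Recursion for the multi-sums *)

Lemma Theta_r0 (R : realType) (m a b : nat) (eps : int) (f : 'rV[R]_m) :
  Theta a b 0 eps f = 1.
Proof.
rewrite /Theta (big_pred1 (ffun0 (card_ord 0))).
  by rewrite big_ord0.
move=> i /=; apply/idP/eqP => _; first by apply/ffunP => -[].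
by apply/andP; split; apply/forallP => -[].
Qed.

Lemma Theta_b0 (R : realType) (m a r : nat) (eps : int) (f : 'rV[R]_m) :
  Theta a 0 r.+1 eps f = 0.
Proof.
rewrite /Theta big_pred0 // => i; apply/negbTE/nandP; left.
by apply/forallPn; exists ord0; rewrite andbF.
Qed.

(** Selections are split by whether their largest index is the ordinal [b]; if so, that index
    carries the last factor of the product. *)
Lemma Theta_recr (R : realType) (m b r : nat) (eps : int) (f : 'rV[R]_m)
    (hb : (b < m)%N) :
  Theta 1 b.+1 r.+1 eps f = Theta 1 b r.+1 eps f +
    Theta 1 b r eps f * f 0 (Ordinal hb) ^ ((-1 : int) ^ (r.+1%:Z + eps)).
Proof.
rewrite {1}/Theta.
rewrite (bigID (fun i : {ffun 'I_r.+1 -> 'I_m} => i ord_max == Ordinal hb)) /=.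
rewrite addrC.
congr (_ + _).
  apply: eq_bigl => i; apply/idP/idP.
    case/andP => /andP[/forallP H1 /forallP H2] H3.
    apply/andP; split; apply/forallP => //= j.
    (* The indices increase, so bounding the last one bounds them all. *)
    have Hm : (i ord_max < b)%N.
      by rewrite ltn_neqAle H3; have := H1 ord_max.
    have [jm|jm] := eqVneq j ord_max; first by rewrite jm.
    apply: leq_ltn_trans Hm; rewrite leq_eqVlt; apply/orP; right.
    apply: implyP (forallP (H2 j) ord_max) _.
    by rewrite ltn_neqAle jm -ltnS ltn_ord.
  case/andP => /forallP H1 H2; rewrite H2 andbT; apply/andP; split.
    by apply/forallP => j; have := H1 j; rewrite /= => /ltnW; rewrite ltnS.
  by rewrite neq_ltn; apply/orP; left; exact: (H1 ord_max).
(* [h] appends the ordinal [b] to a selection and [h'] drops the last index; they are mutually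
   inverse on the selections ending in [b]. *)
pose h (g : {ffun 'I_r -> 'I_m}) : {ffun 'I_r.+1 -> 'I_m} :=
  [ffun j => if unlift ord_max j is Some k then g k else Ordinal hb].
pose h' (g : {ffun 'I_r.+1 -> 'I_m}) : {ffun 'I_r -> 'I_m} :=
  [ffun k => g (lift ord_max k)].
have hl g k : h g (lift ord_max k) = g k by rewrite ffunE liftK.
have hm g : h g ord_max = Ordinal hb by rewrite ffunE unlift_none.
rewrite (reindex_onto h h'); last first.
  move=> i /andP[_ /eqP Hi]; apply/ffunP => j; rewrite ffunE.
  by case: unliftP => [k|] ->; rewrite ?ffunE.
rewrite /Theta mulr_suml; apply: eq_big => [g|g Hg].
  rewrite hm eqxx andbT.
  have -> : h' (h g) == g by apply/eqP/ffunP => k; rewrite ffunE hl.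
  rewrite andbT; apply/idP/idP => /andP[/forallP H1 /forallP H2];
      apply/andP; split; apply/forallP => j.
  - have := forallP (H2 (lift ord_max j)) ord_max.
    by rewrite hm hl lift_max /= ltn_ord.
  - apply/forallP => k; have := forallP (H2 (lift ord_max j)) (lift ord_max k).
    by rewrite !hl !lift_max.
  - case: (unliftP ord_max j) => [k|] ->; rewrite ?hm ?hl //=.
    by have := H1 k; rewrite /= => /ltnW; rewrite ltnS.
  - apply/forallP => l; case: (unliftP ord_max j) => [k|] ->; last first.
      by apply/implyP; rewrite ltnNge -ltnS ltn_ord.
    case: (unliftP ord_max l) => [k'|] ->; rewrite ?hm ?hl ?lift_max.
      exact: (forallP (H2 k)).
    by apply/implyP => _; have := H1 k.
rewrite big_ord_recr /= hm; congr (_ * _); apply: eq_bigr => j _.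
have -> : widen_ord (leqnSn r) j = lift ord_max j.
  by apply: val_inj; rewrite -[RHS]/(nat_of_ord (lift ord_max j)) lift_max.
by rewrite hl.
Qed.

Lemma Theta_small (R : realType) (m b r : nat) (eps : int) (f : 'rV[R]_m) :
  (b <= m)%N -> (b < r)%N -> Theta 1 b r eps f = 0.
Proof.
elim: b r => [|b IH] [|r] // bm br; first by rewrite Theta_b0.
by rewrite (Theta_recr _ _ _ bm) !IH ?mul0r ?addr0 // 1?ltnW // ltnW.
Qed.

(** * Logarithmic gradients *)

Section LogGradient.
Variables (R : realType) (m : nat) (f : 'rV[R]_m).
Implicit Types g h : 'rV[R]_m -> R.

Definition pderivable g := forall i : 'I_m, derivable g f (delta_mx 0 i).

(* Entry i is f_i dg/df_i, the derivative of g in log f_i. *)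
Definition log_grad g : 'rV[R]_m := \row_i (f 0 i * partial i g f).

Lemma pderivable_cst (c : R) : pderivable (fun=> c).
Proof. by move=> i; apply: derivable_cst. Qed.
Arguments pderivable_cst c : clear implicits.

Lemma log_grad_cst (c : R) : log_grad (fun=> c) = 0.
Proof.
by apply/rowP => i; rewrite !mxE /partial (derive_cst c f (delta_mx 0 i)) mulr0.
Qed.

Lemma pderivableD g h :
  pderivable g -> pderivable h -> pderivable (fun x => g x + h x).
Proof. by move=> dg dh i; exact: (derivableD (dg i) (dh i)). Qed.

Lemma log_gradD g h : pderivable g -> pderivable h ->
  log_grad (fun x => g x + h x) = log_grad g + log_grad h.
Proof.
move=> dg dh; apply/rowP => i.
by rewrite !mxE /partial (deriveD (dg i) (dh i)) mulrDr.
Qed.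

Lemma pderivableM g h :
  pderivable g -> pderivable h -> pderivable (fun x => g x * h x).
Proof. by move=> dg dh i; exact: (derivableM (dg i) (dh i)). Qed.

Lemma log_gradM g h : pderivable g -> pderivable h ->
  log_grad (fun x => g x * h x) = g f *: log_grad h + h f *: log_grad g.
Proof.
move=> dg dh; apply/rowP => i; rewrite !mxE /partial (deriveM (dg i) (dh i)).
by rewrite /GRing.scale /=; ring.
Qed.

Lemma pderivableZ c g : pderivable g -> pderivable (fun x => c * g x).
Proof. by move=> dg; exact: (pderivableM (pderivable_cst c) dg). Qed.

Lemma log_gradZ c g :
  pderivable g -> log_grad (fun x => c * g x) = c *: log_grad g.
Proof.
move=> dg; rewrite (log_gradM (pderivable_cst c) dg).
by rewrite log_grad_cst scaler0 addr0.
Qed.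

Lemma pderivable_sum (n : nat) (F : 'I_n -> 'rV[R]_m -> R) :
  (forall k, pderivable (F k)) -> pderivable (fun x => \sum_(k < n) F k x).
Proof.
elim: n F => [|n IH] F dF.
  have -> : (fun x => \sum_(k < 0) F k x) = fun=> 0.
    by apply/funext => x; rewrite big_ord0.
  exact: pderivable_cst.
under [fun x => _]funext do rewrite big_ord_recr /=.
by apply: pderivableD => //; apply: IH.
Qed.

Lemma log_grad_sum (n : nat) (F : 'I_n -> 'rV[R]_m -> R) :
  (forall k, pderivable (F k)) ->
  log_grad (fun x => \sum_(k < n) F k x) = \sum_(k < n) log_grad (F k).
Proof.
elim: n F => [|n IH] F dF.
  have -> : (fun x => \sum_(k < 0) F k x) = fun=> 0.
    by apply/funext => x; rewrite big_ord0.
  by rewrite log_grad_cst big_ord0.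
under [fun x => _]funext do rewrite big_ord_recr /=.
by rewrite log_gradD ?IH ?big_ord_recr //; apply: pderivable_sum.
Qed.

Lemma pderivableV g :
  g f != 0 -> pderivable g -> pderivable (fun x => (g x)^-1).
Proof. by move=> g0 dg i; exact: derivableV. Qed.

Lemma log_gradV g : g f != 0 -> pderivable g ->
  log_grad (fun x => (g x)^-1) = - ((g f) ^- 2 *: log_grad g).
Proof.
move=> g0 dg; apply/rowP => i; rewrite !mxE /partial.
by rewrite (deriveV g0 (dg i)) /GRing.scale /=; ring.
Qed.

Lemma is_derive_coord (k i : 'I_m) :
  is_derive f (delta_mx 0 i : 'rV[R]_m) (fun x : 'rV[R]_m => x 0 k)
    ((k == i)%:R : R).
Proof.
have H : ((fun h : R => h^-1 *: (((fun x : 'rV[R]_m => x 0 k) \o shift f)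
    (h *: delta_mx 0 i) - f 0 k)) @ 0^' --> ((k == i)%:R : R))%classic.
  (* For nonzero [h] the difference quotient already equals its limit. *)
  apply: cvg_near_cst; near=> h.
  rewrite /= !mxE eqxx /= addrK /GRing.scale /= mulKf //.
  by near: h; apply: nbhs_dnbhs_neq.
split; first by apply/cvg_ex; eexists; exact: H.
exact: cvg_lim H.
Unshelve. all: by end_near.
Qed.

Lemma pderivable_coord (k : 'I_m) : pderivable (fun x => x 0 k).
Proof. by move=> i; have [] := is_derive_coord k i. Qed.

Lemma log_grad_coord (k : 'I_m) :
  log_grad (fun x => x 0 k) = f 0 k *: delta_mx 0 k.
Proof.
apply/rowP => i; rewrite !mxE /partial; have [_ ->] := is_derive_coord k i.
by rewrite eqxx /= eq_sym; case: eqP => [->|]; rewrite ?mulr0.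
Qed.

Lemma pderivable_prod (I : Type) (s : seq I) (F : I -> 'rV[R]_m -> R) :
  (forall k, pderivable (F k)) -> pderivable (fun x => \prod_(k <- s) F k x).
Proof.
move=> dF; elim: s => [|k s IH].
  under [fun x => _]funext do rewrite big_nil; exact: pderivable_cst.
by under [fun x => _]funext do rewrite big_cons; exact: pderivableM.
Qed.

Lemma log_grad_monomial (s : seq 'I_m) :
  log_grad (fun x => \prod_(k <- s) x 0 k) =
  \prod_(k <- s) f 0 k *: \row_i (count_mem i s)%:R.
Proof.
elim: s => [|k s IH].
  under [fun x => _]funext do rewrite big_nil.
  by rewrite log_grad_cst; apply/rowP => i; rewrite !mxE mulr0.
under [fun x => _]funext do rewrite big_cons.
rewrite log_gradM; [|exact: pderivable_coord|].
  rewrite log_grad_coord IH big_cons; apply/rowP => i.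
  by rewrite !mxE eqxx /= [i == k]eq_sym natrD; ring.
by apply: pderivable_prod => j; exact: pderivable_coord.
Qed.

(** The weight f_i f_j is absorbed by the two logarithmic derivatives. *)
Lemma poissonE g h : poisson g h f = log_bracket (log_grad g) (log_grad h).
Proof.
rewrite log_bracketE; apply: eq_bigr => i _; apply: eq_bigr => j _.
by rewrite !mxE; ring.
Qed.

End LogGradient.

Arguments pderivable_cst {R m} f c.
Arguments pderivable_coord {R m} f k.
Arguments pderivable_sum {R m f n F}.
Arguments pderivableZ {R m f} c {g}.
Arguments pderivableD {R m f g h}.
Arguments pderivableM {R m f g h}.
Arguments pderivableV {R m f g}.
Arguments log_gradZ {R m f} c {g}.

(** * Entries of the monodromy matrix *)

Lemma exprz_sign (R : unitRingType) (x : R) (r : nat) (i : bool) :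
  x ^ ((-1 : int) ^ (r.+1%:Z + i%:Z)) = site x (~~ odd r (+) i).
Proof.
rewrite -PoszD /exprz -signr_odd oddD /= /site oddb.
by case: (_ (+) _) => /=; rewrite ?expr1z // expr0z.
Qed.

Section MonodromyEntries.
Variables (R : realType) (m : nat).
Implicit Types (f : 'rV[R]_m) (i j k h : bool) (l : R).

(* The entries of L_1(l) ... L_b(l), exactly so when b < N; a larger N is
   harmless since Theta vanishes beyond length b. *)
Definition entry (N b : nat) l i j (f : 'rV[R]_m) : R :=
  \sum_(r < N) ((odd r == i (+) j)%:R * l ^+ r) * Theta 1 b r i%:Z f.

Lemma entry0 N l i j f : entry N.+1 0 l i j f = (i == j)%:R.
Proof.
rewrite /entry big_ord_recl big1 => [|r _]; last by rewrite Theta_b0 mulr0.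
by rewrite Theta_r0 expr0 !mulr1 addr0; case: i; case: j.
Qed.

(** This is right multiplication by the matrix L of the new site, read off in column [j]. *)
Lemma entry_recr N b l i j f (hb : (b < m)%N) : (b < N)%N ->
  entry N.+1 b.+1 l i j f = entry N.+1 b l i j f +
    l * (site (f 0 (Ordinal hb)) j * entry N.+1 b l i (~~ j) f).
Proof.
move=> bN; rewrite /entry big_ord_recl [in X in _ = X + _]big_ord_recl.
rewrite -addrA; congr (_ + _); first by rewrite !Theta_r0.
(* The factor [l] shifts degrees by one, so the top term, of degree [N], has no partner; it vanishes
   because [b < N]. *)
rewrite [X in site _ _ * X]big_ord_recr /= (Theta_small _ _ (ltnW hb) bN).
rewrite mulr0 addr0 !mulr_sumr -big_split; apply: eq_bigr => r _ /=.
rewrite (Theta_recr _ _ _ hb) exprz_sign.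
rewrite /bump leq0n add1n add0n exprS.
by case: i; case: j; case: (odd r) => /=; ring.
Qed.

Lemma pderivable_site f (k : 'I_m) j :
  f 0 k != 0 -> pderivable f (fun x => site (x 0 k) j).
Proof.
move=> fk; have dk := pderivable_coord f k.
by case: j => //=; apply: pderivableV.
Qed.

Lemma log_grad_site f (k : 'I_m) j : f 0 k != 0 ->
  log_grad f (fun x => site (x 0 k) j) =
  (bsgn R j * site (f 0 k) j) *: delta_mx 0 k.
Proof.
move=> fk; have dk := pderivable_coord f k.
case: j => /=; last by rewrite log_grad_coord mul1r.
rewrite log_gradV // log_grad_coord scalerA -scaleNr; congr (_ *: _).
by field.
Qed.

Lemma pderivable_Theta f b r i : (forall p, f 0 p != 0) -> (b <= m)%N ->
  pderivable f (Theta 1 b r i%:Z).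
Proof.
move=> f0; elim: b r => [|b IH] [|r] bm.
- have -> : @Theta R m 1 0 0 i%:Z = fun=> 1.
    by apply/funext => x; rewrite Theta_r0.
  exact: pderivable_cst.
- have -> : @Theta R m 1 0 r.+1 i%:Z = fun=> 0.
    by apply/funext => x; rewrite Theta_b0.
  exact: pderivable_cst.
- have -> : @Theta R m 1 b.+1 0 i%:Z = fun=> 1.
    by apply/funext => x; rewrite Theta_r0.
  exact: pderivable_cst.
under [X in pderivable _ X]funext do rewrite (Theta_recr _ _ _ bm) exprz_sign.
apply: pderivableD; first by apply: IH; exact: ltnW.
apply: pderivableM; first by apply: IH; exact: ltnW.
exact: pderivable_site.
Qed.

Lemma pderivable_entry f N b l i j : (forall p, f 0 p != 0) -> (b <= m)%N ->
  pderivable f (entry N b l i j).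
Proof.
move=> f0 bm; apply: pderivable_sum => r; apply: pderivableZ.
exact: pderivable_Theta.
Qed.

(** The right side has the exact shape of the arguments in [log_bracket_step]. *)
Lemma log_grad_entry_recr f N b l i j (hb : (b < m)%N) :
  (forall p, f 0 p != 0) -> (b < N)%N ->
  log_grad f (entry N.+1 b.+1 l i j) = log_grad f (entry N.+1 b l i j) +
    ((l * site (f 0 (Ordinal hb)) j) *: log_grad f (entry N.+1 b l i (~~ j)) +
     (l * site (f 0 (Ordinal hb)) j * bsgn R j * entry N.+1 b l i (~~ j) f)
       *: delta_mx 0 (Ordinal hb)).
Proof.
move=> f0 bN.
have de i' j' : pderivable f (entry N.+1 b l i' j').
  by apply: pderivable_entry => //; exact: ltnW.
have ds j' : pderivable f (fun x => site (x 0 (Ordinal hb)) j').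
  exact: pderivable_site.
under [X in log_grad _ X]funext do rewrite (entry_recr _ _ _ _ hb bN).
rewrite (log_gradD (de _ _) (pderivableZ _ (pderivableM (ds _) (de _ _)))).
rewrite (log_gradZ _ (pderivableM (ds _) (de _ _))) (log_gradM (ds _) (de _ _)).
rewrite log_grad_site //; congr (_ + _); rewrite scalerDr !scalerA.
by congr (_ + _ *: _); ring.
Qed.

Lemma log_grad_entry0 f N l i j : log_grad f (entry N.+1 0 l i j) = 0.
Proof.
under [X in log_grad _ X]funext do rewrite entry0.
exact: log_grad_cst.
Qed.

Lemma log_grad_entry_supp f N b l i j (k : 'I_m) :
  (forall p, f 0 p != 0) -> (b <= m)%N -> (b <= N)%N -> (b <= k)%N ->
  log_grad f (entry N.+1 b l i j) 0 k = 0.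
Proof.
move=> f0; elim: b i j => [|b IH] i j bm bN bk.
  by rewrite log_grad_entry0 mxE.
rewrite (log_grad_entry_recr _ _ _ bm) //.
have H i' j' := IH i' j' (ltnW bm) (ltnW bN) (ltnW bk).
have kb : (k == Ordinal bm) = false.
  by apply/negbTE; rewrite -val_eqE /= neq_ltn bk orbT.
rewrite mxE H mxE [X in _ + (X + _)]mxE H [X in _ + (_ + X)]mxE mxE kb.
by rewrite andbF !mulr0 !addr0.
Qed.

(* The Euler operator acts on M as half the commutator with diag(1, -1). *)
Lemma sum_log_grad_entry f N b l i j :
  (forall p, f 0 p != 0) -> (b <= m)%N -> (b <= N)%N ->
  \sum_k log_grad f (entry N.+1 b l i j) 0 k =
  (bsgn R j - bsgn R i) / 2 * entry N.+1 b l i j f.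
Proof.
move=> f0; elim: b i j => [|b IH] i j bm bN.
  rewrite entry0 big1 => [|k _]; last by rewrite log_grad_entry0 mxE.
  by case: i; case: j => /=; field.
rewrite (log_grad_entry_recr _ _ _ bm) // (entry_recr _ _ _ _ bm) //.
under eq_bigr => k _ do rewrite mxE [X in _ + X]mxE [X in _ + (X + _)]mxE
  [X in _ + (_ + X)]mxE.
rewrite !big_split -!mulr_sumr /= !IH //; try exact: ltnW.
rewrite (bigD1 (Ordinal bm)) //= big1 => [|k /negbTE kb]; last first.
  by rewrite mxE kb andbF.
rewrite mxE !eqxx /=.
by case: i; case: j => /=; field.
Qed.

Lemma log_bracket_entry f N b l n i j k h :
  (forall p, f 0 p != 0) -> (b <= m)%N -> (b <= N)%N -> n ^+ 2 - l ^+ 2 != 0 ->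
  log_bracket (log_grad f (entry N.+1 b l i j))
    (log_grad f (entry N.+1 b n k h)) =
  quad_bracket l n (fun i j => entry N.+1 b l i j f)
    (fun i j => entry N.+1 b n i j f) i j k h.
Proof.
move=> f0 + + D0; elim: b i j k h => [|b IH] i j k h bm bN.
  rewrite !log_grad_entry0 log_bracket0r /quad_bracket !entry0.
  (* With no sites both matrices are the identity, where the quadratic expression vanishes. *)
  by case: i; case: j; case: k; case: h => /=; field.
rewrite !(log_grad_entry_recr _ _ _ bm) //.
(* The new variable follows all those occurring in the entry, so its bracket reduces to the Euler
   operator. *)
have E q i' j' : log_bracket (log_grad f (entry N.+1 b q i' j'))
    (delta_mx 0 (Ordinal bm)) =
    (bsgn R j' - bsgn R i') / 2 * entry N.+1 b q i' j' f.
  rewrite log_bracket_delta => [|k' bk]; last first.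
    by apply: log_grad_entry_supp => //; exact: ltnW.
  by apply: sum_log_grad_entry => //; exact: ltnW.
have IHb i' j' k' h' := IH i' j' k' h' (ltnW bm) (ltnW bN).
rewrite (log_bracket_step (f0 _) D0 IHb (E l) (E n)).
by congr quad_bracket; apply/funext => i'; apply/funext => j';
  rewrite (entry_recr _ _ _ _ bm) // mulrA.
Qed.

End MonodromyEntries.

Arguments pderivable_Theta {R m f b} r i.
Arguments pderivable_entry {R m f} N {b} l i j.

(** * Generating function of the integrals *)

(** The two arguments are the logarithmic gradients of H(l) and H(m), with [w] that of log p and [q]
    the value of p. Once the bracket relations are inserted, all terms quadratic in [M] and [N]
    cancel. *)
Lemma log_bracket_combination (R : numFieldType) (d : nat) (q l m a1 a2 a3 : R)
  (w : 'rV[R]_d) (M N : bool -> bool -> R) (G H : bool -> bool -> 'rV[R]_d) :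
  q != 0 -> l != 0 -> m != 0 -> m ^+ 2 - l ^+ 2 != 0 ->
  (forall i j k h, log_bracket (G i j) (H k h) = quad_bracket l m M N i j k h) ->
  (forall i j, log_bracket (G i j) w = (bsgn R j - bsgn R i) / 2 * M i j) ->
  (forall i j, log_bracket (H i j) w = (bsgn R j - bsgn R i) / 2 * N i j) ->
  log_bracket
    (a1 *: (q *: G true true + (q * M true true) *: w +
            (q^-1 *: G false false + (- q^-1 * M false false) *: w)) +
     (a2 / l) *: G true false + (a3 / l) *: G false true)
    (a1 *: (q *: H true true + (q * N true true) *: w +
            (q^-1 *: H false false + (- q^-1 * N false false) *: w)) +
     (a2 / m) *: H true false + (a3 / m) *: H false true) = 0.
Proof.
move=> q0 l0 m0 D0 GH Gw Hw.
rewrite !(log_bracketDl, log_bracketDr, log_bracketZl, log_bracketZr).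
rewrite log_bracketvv !(log_bracketC w) !GH !Gw !Hw /quad_bracket /=.
by field; rewrite ?q0 ?l0 ?m0 ?D0.
Qed.

Lemma sum_even_odd (V : nmodType) (n : nat) (F : nat -> V) :
  \sum_(k < 2 * n) F k = \sum_(k < n) (F (2 * k)%N + F (2 * k).+1).
Proof.
elim: n => [|n IH]; first by rewrite muln0 !big_ord0.
by rewrite mulnS !big_ord_recr /= IH addrA.
Qed.

(* The logarithmic gradient of p, up to the factor p: as ordinals start at 0,
   odd ordinals are the even indices. *)
Definition alt_row (R : pzRingType) (m : nat) : 'rV[R]_m :=
  \row_(k < m) ((odd k)%:R - (~~ odd k)%:R).

(** Ordinals are grouped in pairs 2k, 2k+1. A pair not containing [i] contributes 0, as its two
    opposite entries meet the same sign; the pair of [i] contributes 1. *)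
Lemma log_bracket_alt (R : numFieldType) (n : nat) (u : 'rV[R]_(2 * n)) :
  log_bracket u (alt_row R _) = \sum_k u 0 k.
Proof.
rewrite /log_bracket -mulmxA mxE; apply: eq_bigr => i _.
rewrite mxE -[RHS]mulr1; congr (_ * _).
pose F k : R := ((i < k)%:R - (k < i)%:R) * ((odd k)%:R - (~~ odd k)%:R).
under eq_bigr => k _ do rewrite !mxE -/(F k).
have i2 : (i./2 < n)%N by have := ltn_ord i; lia.
rewrite sum_even_odd (bigD1 (Ordinal i2)) //= big1 => [|k].
  rewrite /F addr0 /= oddM /=.
  have -> : (i < 2 * i./2)%N = false by lia.
  have -> : ((2 * i./2).+1 < i)%N = false by lia.
  have -> : (2 * i./2 < i)%N = odd i by lia.
  have -> : (i < (2 * i./2).+1)%N = ~~ odd i by lia.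
  by case: (odd i) => /=; ring.
rewrite -val_eqE /F /= oddM /= => ki.
case: (ltnP i (2 * k)) => ik.
  have -> : (i < (2 * k).+1)%N by lia.
  have -> : (2 * k < i)%N = false by lia.
  have -> : ((2 * k).+1 < i)%N = false by lia.
  ring.
have -> : (i < (2 * k).+1)%N = false by lia.
have -> : (2 * k < i)%N by lia.
have -> : ((2 * k).+1 < i)%N by lia.
ring.
Qed.

(** A polynomial vanishing on a half-line is zero. The bound [c] serves to keep one parameter
    positive and the other larger than the first. *)
Lemma polyfun_eq0 (R : realFieldType) (n : nat) (c : R) (a : 'I_n -> R) :
  (forall t, c < t -> \sum_(k < n) t ^+ k * a k = 0) -> forall k, a k = 0.
Proof.
move=> Ha k; pose b i := if insub i is Some k' then a k' else 0.
pose p := \poly_(i < n) b i.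
have bE (k' : 'I_n) : b k' = a k' by rewrite /b valK.
suff p0 : p = 0 by have := coef_poly n b k; rewrite -/p p0 coef0 ltn_ord bE.
apply/eqP; apply: contraT => pn0.
(* These are [n] distinct roots beyond [c], too many for a nonzero polynomial of degree below
   [n]. *)
pose rs := [seq c + 1 + i%:R | i <- iota 0 n].
have : (size rs < size p)%N.
  apply: max_poly_roots pn0 _ _.
    apply/allP => t /mapP[i _ ->]; apply/rootP; rewrite horner_poly.
    rewrite -[RHS](Ha (c + 1 + i%:R)) ?(ltr_wpDr _ (ltrDl _ _)) //; last first.
      by rewrite -addrA ltrDl ltr_pwDl.
    by apply: eq_bigr => j _; rewrite bE mulrC.
  rewrite map_inj_uniq ?iota_uniq // => i j /addrI /eqP.
  by rewrite eqr_nat => /eqP.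
by rewrite size_map size_iota ltnNge size_poly.
Qed.

Section Integrals.
Variables (R : realType) (n : nat) (f : 'rV[R]_(2 * n)).
Hypothesis f0 : forall p, f 0 p != 0.

Lemma prod_evenE (x : 'rV[R]_(2 * n)) :
  prod_even x = \prod_(k <- [seq k : 'I_(2 * n) <- index_enum _ | odd k]) x 0 k.
Proof. by rewrite big_filter. Qed.

Lemma prod_oddE (x : 'rV[R]_(2 * n)) :
  prod_odd x =
  \prod_(k <- [seq k : 'I_(2 * n) <- index_enum _ | ~~ odd k]) x 0 k.
Proof. by rewrite big_filter. Qed.

Lemma count_mem_filter_index_enum (P : pred 'I_(2 * n)) i :
  count_mem i [seq k : 'I_(2 * n) <- index_enum _ | P k] = P i.
Proof.
rewrite count_uniq_mem ?filter_uniq ?index_enum_uniq //.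
by rewrite mem_filter mem_index_enum andbT.
Qed.

Lemma prod_even_neq0 : prod_even f != 0.
Proof. by apply/prodf_neq0 => i _. Qed.

Lemma prod_odd_neq0 : prod_odd f != 0.
Proof. by apply/prodf_neq0 => i _. Qed.

Lemma pderivable_prod_even : pderivable f (@prod_even R (2 * n)).
Proof.
under [X in pderivable _ X]funext do rewrite prod_evenE.
by apply: pderivable_prod => k; exact: pderivable_coord.
Qed.

Lemma pderivable_prod_odd : pderivable f (@prod_odd R (2 * n)).
Proof.
under [X in pderivable _ X]funext do rewrite prod_oddE.
by apply: pderivable_prod => k; exact: pderivable_coord.
Qed.

Let q (x : 'rV[R]_(2 * n)) := prod_even x / prod_odd x.
Let q' (x : 'rV[R]_(2 * n)) := prod_odd x / prod_even x.

Lemma pderivable_ratio : pderivable f q /\ pderivable f q'.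
Proof.
have de := pderivable_prod_even; have dO := pderivable_prod_odd.
split; first exact: (pderivableM de (pderivableV prod_odd_neq0 dO)).
exact: (pderivableM dO (pderivableV prod_even_neq0 de)).
Qed.

(** The two ratios are mutually inverse, so one row vector serves both, up to sign. *)
Lemma log_grad_ratio :
  log_grad f q = q f *: alt_row R _ /\ log_grad f q' = - q' f *: alt_row R _.
Proof.
have e0 := prod_even_neq0; have o0 := prod_odd_neq0.
have de := pderivable_prod_even; have dO := pderivable_prod_odd.
have ge : log_grad f (@prod_even R (2 * n)) = prod_even f *: \row_i (odd i)%:R.
  under [X in log_grad _ X]funext do rewrite prod_evenE.
  rewrite log_grad_monomial -prod_evenE; congr (_ *: _); apply/rowP => i.
  by rewrite !mxE count_mem_filter_index_enum.
have go : log_grad f (@prod_odd R (2 * n)) = prod_odd f *: \row_i (~~ odd i)%:R.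
  under [X in log_grad _ X]funext do rewrite prod_oddE.
  rewrite log_grad_monomial -prod_oddE; congr (_ *: _); apply/rowP => i.
  by rewrite !mxE count_mem_filter_index_enum.
split.
  rewrite (log_gradM de (pderivableV o0 dO)) (log_gradV o0 dO) ge go.
  by apply/rowP => i; rewrite !mxE /q; field.
rewrite (log_gradM dO (pderivableV e0 de)) (log_gradV e0 de) ge go.
by apply/rowP => i; rewrite !mxE /q'; field.
Qed.

Variables a1 a2 a3 : R.

Lemma pderivable_integral r : pderivable f (integral_I a1 a2 a3 r).
Proof.
have [dq dq'] := pderivable_ratio.
have dT s (i : bool) : pderivable f (Theta 1 (2 * n) s i%:Z).
  exact: (pderivable_Theta _ _ f0 (leqnn _)).
apply: pderivableD; last exact: (pderivableZ a3 (dT _ false)).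
apply: pderivableD; last exact: (pderivableZ a2 (dT _ true)).
apply: pderivableZ; apply: pderivableD.
  exact: (pderivableM dq (dT _ true)).
exact: (pderivableM dq' (dT _ false)).
Qed.

Arguments pderivable_integral : clear implicits.

(** The bound 2n + 2 makes the degrees fall into pairs 2r, 2r+1 with r from 0 to n. *)
Let T (l : R) i j (x : 'rV[R]_(2 * n)) := entry (2 * n).+2 (2 * n) l i j x.

(** Diagonal entries collect the even degrees and off-diagonal ones the odd degrees, whence the
    division by [l]. The range reaches r = n because the multi-sum of full length 2n occurs on the
    diagonal. *)
Lemma integral_generating l x : l != 0 ->
  \sum_(r < n.+1) (l ^+ 2) ^+ r * integral_I a1 a2 a3 r x =
  a1 * (q x * T l true true x + q' x * T l false false x) +
  (a2 / l) * T l true false x + (a3 / l) * T l false true x.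
Proof.
move=> l0.
have E (i j : bool) : T l i j x = \sum_(r < n.+1) (l ^+ 2) ^+ r *
    (if i == j then Theta 1 (2 * n) (2 * r) i%:Z x
     else l * Theta 1 (2 * n) (2 * r + 1) i%:Z x).
  rewrite /T /entry -[in LHS](addn2 (2 * n)) addnC -mulnS.
  rewrite (sum_even_odd n.+1 (fun r => ((odd r == i (+) j)%:R * l ^+ r) *
     Theta 1 (2 * n) r i%:Z x)).
  apply: eq_bigr => r _; rewrite /= oddM /= addn1 exprS exprM.
  by case: i; case: j => /=; ring.
rewrite !E !mulr_sumr -!big_split mulr_sumr -!big_split /=.
apply: eq_bigr => r _; rewrite /integral_I -/(q x) -/(q' x) /=.
by move: (q x) (q' x) => u v; field.
Qed.

Lemma log_grad_integral_generating l : l != 0 ->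
  \sum_(r < n.+1) (l ^+ 2) ^+ r *: log_grad f (integral_I a1 a2 a3 r) =
  a1 *: (q f *: log_grad f (T l true true) +
         (q f * T l true true f) *: alt_row R _ +
         ((q f)^-1 *: log_grad f (T l false false) +
          (- (q f)^-1 * T l false false f) *: alt_row R _)) +
  (a2 / l) *: log_grad f (T l true false) +
  (a3 / l) *: log_grad f (T l false true).
Proof.
move=> l0; have [dq dq'] := pderivable_ratio; have [gq gq'] := log_grad_ratio.
have dT i j : pderivable f (T l i j) := pderivable_entry _ _ _ _ f0 (leqnn _).
under eq_bigr => r _ do rewrite -(log_gradZ _ (pderivable_integral r)).
rewrite -log_grad_sum => [|r]; last exact/pderivableZ/pderivable_integral.
under [X in log_grad _ X]funext do rewrite integral_generating //.
have d1 := pderivableM dq (dT true true).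
have d2 := pderivableM dq' (dT false false).
have d3 := pderivableZ a1 (pderivableD d1 d2).
have d4 := pderivableZ (a2 / l) (dT true false).
have d5 := pderivableZ (a3 / l) (dT false true).
rewrite (log_gradD (pderivableD d3 d4) d5) (log_gradD d3 d4).
rewrite (log_gradZ _ (pderivableD d1 d2)) (log_gradD d1 d2).
rewrite (log_gradM dq (dT _ _)) (log_gradM dq' (dT _ _)) !(log_gradZ _ (dT _ _)).
rewrite gq gq' !scalerA; have -> : (q f)^-1 = q' f by rewrite /q /q' invf_div.
by rewrite (mulrC (T l true true f)) (mulrC (T l false false f)).
Qed.

Lemma integral_generating_commute l m :
  l != 0 -> m != 0 -> m ^+ 2 - l ^+ 2 != 0 ->
  log_bracket
    (\sum_(r < n.+1) (l ^+ 2) ^+ r *: log_grad f (integral_I a1 a2 a3 r))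
    (\sum_(r < n.+1) (m ^+ 2) ^+ r *: log_grad f (integral_I a1 a2 a3 r)) = 0.
Proof.
move=> l0 m0 D0; rewrite !log_grad_integral_generating //.
apply: (@log_bracket_combination _ _ _ _ _ _ _ _ _
  (fun i j => T l i j f) (fun i j => T m i j f)
  (fun i j => log_grad f (T l i j)) (fun i j => log_grad f (T m i j))) => //.
- by rewrite /q mulf_neq0 ?invr_neq0 ?prod_even_neq0 ?prod_odd_neq0.
- by move=> i j k h; apply: log_bracket_entry.
- by move=> i j; rewrite log_bracket_alt; apply: sum_log_grad_entry.
- by move=> i j; rewrite log_bracket_alt; apply: sum_log_grad_entry.
Qed.

End Integrals.

(** * Separation of the coefficients in both parameters *)

Unset Implicit Arguments.

Theorem theorem4 (R : realType) (n : nat) (hn : (1 <= n)%N)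
    (alpha1 alpha2 alpha3 : R) (r s : nat)
    (hr : (r <= n - 1)%N) (hs : (s <= n - 1)%N)
    (f : 'rV[R]_(2 * n)) (hf : forall i, f 0 i != 0) :
  poisson (integral_I alpha1 alpha2 alpha3 r)
          (integral_I alpha1 alpha2 alpha3 s) f = 0.
Proof.
rewrite poissonE.
pose g k := log_grad f (@integral_I R n alpha1 alpha2 alpha3 k).
have rn : (r < n.+1)%N by lia.
have sn : (s < n.+1)%N by lia.
suff H (t : R) : 0 < t -> \sum_(k < n.+1) t ^+ k * log_bracket (g k) (g s) = 0.
  exact: (polyfun_eq0 H (Ordinal rn)).
move=> t0.
(* With [t] fixed, the restriction to [u > t] keeps the two parameters distinct. *)
suff H (u : R) : t < u -> \sum_(h < n.+1) u ^+ h *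
    (\sum_(k < n.+1) t ^+ k * log_bracket (g k) (g h)) = 0.
  exact: (polyfun_eq0 H (Ordinal sn)).
move=> tu; have u0 := lt_trans t0 tu.
(* The generating function is a polynomial in the square of its parameter, so l and m are taken as
   the square roots of [t] and [u]. *)
have st : Num.sqrt t != 0 by rewrite gt_eqF // sqrtr_gt0.
have su : Num.sqrt u != 0 by rewrite gt_eqF // sqrtr_gt0.
have := integral_generating_commute hf alpha1 alpha2 alpha3 st su.
rewrite !sqr_sqrtr ?ltW // subr_eq0 gt_eqF // => /(_ isT) H.
exact: etrans (esym (log_bracket_sum _ _ _ _)) H.
Qed.
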